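(* Every amoeba is balanceable.
   Context: Graphs are finite and simple; $n(G)=|V(G)|$, $e(G)=|E(G)|$. Amoebas. Isolated vertices play no role here, so copies of $G$ in $K_n$ are regarded as determined by their edge sets. For a graph $G$ embedded in $K_n$, $n\ge n(G)$, a graph $H$ embedded in $K_n$ is obtained from $G$ by an edge-replacement if for some $e_1\in E(G)$ and $e_2\in E(K_n)\setminus E(G)$ we have $E(H)=(E(G)\setminus\{e_1\})\cup\{e_2\}$. A graph $G$ is an amoeba if there is an integer $n_0=n_0(G)>n(G)$ such that for all $n\ge n_0$ and any two copies $F$ and $H$ of $G$ in $K_n$ there is a chain $F=G_0,G_1,\dots,G_t=H$ such that, for every $i\in\{1,\dots,t\}$, $G_i\cong G$ and $G_i$ is obtained from $G_{i-1}$ by an edge-replacement. Balanceable graphs. A $2$-coloring $E(K_n)=E(R)\cup E(B)$ is a partition of the edges of $K_n$ into red edges (forming $R$) and blue edges (forming $B$). An $(r,b)$-colored copy of $G$ (with $r+b=e(G)$) is a (not necessarily induced) subgraph of $K_n$ isomorphic to $G$ with exactly $r$ red and $b$ blue edges. A balanced copy of $G$ is an $(e(G)/2,e(G)/2)$-colored copy if $e(G)$ is even, and a copy that is either $(\lceil e(G)/2\rceil,\lfloor e(G)/2\rfloor)$-colored or $(\lfloor e(G)/2\rfloor,\lceil e(G)/2\rceil)$-colored if $e(G)$ is odd. ${\rm bal}(n,G)$ is the minimum non-negative integer $s$ such that every $2$-coloring $E(K_n)=E(R)\cup E(B)$ with $\min\{e(R),e(B)\}>s$ contains a balanced copy of $G$.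 The graph $G$ is balanceable if for every sufficiently large $n$ such an integer exists non-vacuously, that is, ${\rm bal}(n,G)<\lfloor\frac12\binom n2\rfloor$ (so that there are colorings with $\min\{e(R),e(B)\}>{\rm bal}(n,G)$). *)

(* Defs.v *)
From mathcomp Require Import all_boot.

Set Implicit Arguments.
Unset Strict Implicit.
Unset Printing Implicit Defensive.

Record sgraph := SGraph {
  svertex :> finType;
  sedge : rel svertex;
  sedge_sym : symmetric sedge;
  sedge_irrefl : irreflexive sedge }.

Definition edges (G : sgraph) : {set {set G}} :=
  [set [set p.1; p.2] | p : G * G & sedge p.1 p.2].

Section CompleteGraph.
Variable n : nat.

Definition complete_rel : rel 'I_n := fun x y => x != y.

Lemma complete_rel_sym : symmetric complete_rel.
Proof. by move=> x y; rewrite /complete_rel eq_sym. Qed.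

Lemma complete_rel_irrefl : irreflexive complete_rel.
Proof. by move=> x; rewrite /complete_rel eqxx. Qed.

Definition complete : sgraph := SGraph complete_rel_sym complete_rel_irrefl.

End CompleteGraph.

(* A subgraph of K_n is given by its edge set only, isolated vertices being
   irrelevant: F is a copy of G when it is the image of E(G) under an injection
   of V(G) into V(K_n). *)
Definition is_copy (G : sgraph) (n : nat) (F : {set {set complete n}}) : bool :=
  [exists f : {ffun G -> complete n},
     injectiveb f && (F == [set f @: A | A : {set G} in edges G])].

Definition edge_replacement (n : nat) : rel {set {set complete n}} :=
  fun F H =>
    [exists e1 in F, exists e2 in edges (complete n) :\: F,
       H == e2 |: (F :\ e1)].

Definition amoeba (G : sgraph) : Prop :=
  exists n0 : nat, #|G| < n0 /\
    forall n : nat, n0 <= n ->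
    forall F H : {set {set complete n}}, is_copy G F -> is_copy G H ->
    exists s : seq {set {set complete n}},
      [/\ path (@edge_replacement n) F s, all (is_copy G (n:=n)) s
        & last F s = H].

Definition two_coloring (n : nat) (R B : {set {set complete n}}) : bool :=
  (R :|: B == edges (complete n)) && [disjoint R & B].

Definition colored_copy (G : sgraph) (n : nat) (R B : {set {set complete n}})
    (r b : nat) (F : {set {set complete n}}) : bool :=
  [&& is_copy G F, #|F :&: R| == r & #|F :&: B| == b].

Definition balanced_copy (G : sgraph) (n : nat) (R B : {set {set complete n}})
    (F : {set {set complete n}}) : bool :=
  let e := #|edges G| in
  if odd e then
    colored_copy G R B (uphalf e) e./2 F || colored_copy G R B e./2 (uphalf e) F
  else colored_copy G R B e./2 e./2 F.

Definition forces_balanced (G : sgraph) (n s : nat) : bool :=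
  [forall R : {set {set complete n}}, forall B : {set {set complete n}},
     two_coloring R B && (s < minn #|R| #|B|) ==>
     [exists F : {set {set complete n}}, balanced_copy G R B F]].

(* The threshold s always exists, vacuously if it is large enough. *)
Lemma forces_balanced_ex (G : sgraph) (n : nat) :
  exists s, forces_balanced G n s.
Proof.
exists #|{set complete n}|; apply/forallP => R; apply/forallP => B.
apply/implyP => /andP[_]; rewrite leq_min => /andP[ltR _].
by have := leq_trans ltR (max_card R); rewrite ltnn.
Qed.

Definition bal (n : nat) (G : sgraph) : nat := ex_minn (forces_balanced_ex G n).

Definition balanceable (G : sgraph) : Prop :=
  exists N : nat, forall n : nat, N <= n -> bal n G < 'C(n, 2)./2.

(* Main.v *)
(** In a coloring whose classes differ by at most one edge, a uniformly random
    copy of G has on average almost as many red as blue edges, so some copy has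
    at least e(G)/2 (rounded down) red edges and some copy at least as many blue
    ones.  An edge-replacement changes the number of red edges by at most one,
    so a chain of copies joining these two contains a balanced copy.  The
    threshold s = 'C(n, 2)./2 - 1 only has to deal with such colorings. *)
Require Import Defs.
From mathcomp Require Import all_boot.
From mathcomp Require Import fingroup perm zify.

Lemma card_edge (G : sgraph) (A : {set G}) : A \in edges G -> #|A| = 2.
Proof.
case/imsetP=> -[x y]; rewrite inE /= => exy ->; rewrite cards2.
by case: eqVneq exy => // ->; rewrite sedge_irrefl.
Qed.

Lemma edges_complete (n : nat) :
  edges (complete n) = [set A : {set complete n} | #|A| == 2].
Proof.
apply/setP=> A; rewrite inE; apply/idP/idP => [/card_edge -> //|].
by case/cards2P=> x [y [xy ->]]; apply/imsetP; exists (x, y); rewrite ?inE.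
Qed.

Lemma card_edges_complete (n : nat) : #|edges (complete n)| = 'C(n, 2).
Proof. by rewrite edges_complete card_draws card_ord. Qed.

Section Copies.
Variables (G : sgraph) (n : nat).
Implicit Types F : {set {set complete n}}.

Lemma is_copyP F :
  reflect (exists2 f : G -> complete n, injective f &
             F = [set f @: A | A : {set G} in edges G])
          (is_copy G F).
Proof.
apply: (iffP existsP) => [[f /andP[/injectiveP fI /eqP ->]]|[f fI ->]].
  by exists f.
exists [ffun x => f x]; apply/andP; split.
  by apply/injectiveP => x y; rewrite !ffunE => /fI.
apply/eqP/eq_imset => A; apply: eq_imset => x.
by rewrite ffunE.
Qed.

Lemma copy_card {F} : is_copy G F -> #|F| = #|edges G|.
Proof. by case/is_copyP=> f fI ->; rewrite card_imset //; apply: imset_inj. Qed.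

Lemma copy_sub {F} : is_copy G F -> F \subset edges (complete n).
Proof.
case/is_copyP=> f fI ->; apply/subsetP => _ /imsetP[A /card_edge A2 ->].
by rewrite edges_complete inE card_imset // A2.
Qed.

Lemma copy_ex : #|G| <= n -> exists F, is_copy G F.
Proof.
move=> leGn; pose f (x : G) : complete n := widen_ord leGn (enum_rank x).
exists [set f @: A | A : {set G} in edges G]; apply/is_copyP; exists f => //.
by move=> x y /(congr1 val) /= /val_inj /enum_rank_inj.
Qed.

Lemma copy_perm (s : {perm complete n}) F :
  is_copy G F -> is_copy G [set s @: A | A : {set complete n} in F].
Proof.
case/is_copyP=> f fI ->; apply/is_copyP; exists (s \o f).
  exact: inj_comp perm_inj fI.
by rewrite -imset_comp; apply: eq_imset => A; rewrite /= -imset_comp.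
Qed.

End Copies.

Lemma perm_pair_transitive (T : finType) (A B : {set T}) :
  #|A| = 2 -> #|B| = 2 -> exists s : {perm T}, s @: A = B.
Proof.
move=> /eqP/cards2P[x [y [xy ->]]] /eqP/cards2P[x' [y' [xy' ->]]].
(* The first transposition sends [x] to [x']; the second sends the image of [y] to [y'] and fixes
   [x'], which differs from both. *)
exists (tperm x x' * tperm (tperm x x' y) y')%g.
rewrite imsetU1 imset_set1 !permM tpermL [tperm _ y' (tperm _ _ y)]tpermL.
by rewrite tpermD // 1?eq_sym // -{1}(tpermL x x') (inj_eq perm_inj).
Qed.

Section Averaging.
Variables (n : nat) (F : {set {set complete n}}).
Let orb (s : {perm complete n}) := [set s @: A | A : {set complete n} in F].

(** Double counting of pairs of a permutation and an edge of [S] in its image of [F]: by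
    transitivity on edges, each edge is covered by the same number [c] of permutations. *)
Lemma sum_perm_meet : exists c, forall S : {set {set complete n}},
  S \subset edges (complete n) -> \sum_s #|orb s :&: S| = c * #|S|.
Proof.
have [E0|[A0 A0E]] := set_0Vmem (edges (complete n)).
  exists 0 => S; rewrite E0 subset0 => /eqP ->.
  by apply: big1 => s _; rewrite setI0 cards0.
exists (\sum_s (A0 \in orb s)) => S /subsetP SE.
have meetE s : #|orb s :&: S| = \sum_(A in S) (A \in orb s).
  rewrite -sum1_card big_mkcond [RHS]big_mkcond; apply: eq_bigr => A _.
  by rewrite inE andbC; case: (A \in S) => //; case: (A \in _).
rewrite (eq_bigr _ (fun s _ => meetE s)) exchange_big mulnC -sum_nat_const.
apply: eq_bigr => A /SE/card_edge A2.
have [t <-] := perm_pair_transitive _ _ _ (card_edge _ _ A0E) A2.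
(* Right translation by [t] matches the permutations covering [A0] with those covering [t @: A0]. *)
rewrite (reindex_inj (mulIg t)); apply: eq_bigr => s _; congr (nat_of_bool _).
have -> : orb (s * t)%g = [set t @: B | B : {set complete n} in orb s].
  rewrite -imset_comp; apply: eq_imset => B /=.
  by rewrite -imset_comp; apply: eq_imset => x; rewrite permM.
by rewrite mem_imset //; apply/imset_inj/perm_inj.
Qed.

Lemma card_meet_coloring (R B S : {set {set complete n}}) :
  two_coloring R B -> S \subset edges (complete n) ->
  #|S :&: R| + #|S :&: B| = #|S|.
Proof.
case/andP=> /eqP RB dRB SE.
rewrite -cardsUI setIACA setIid (disjoint_setI0 dRB) setI0 cards0 addn0.
by rewrite -setIUr RB (setIidPl SE).
Qed.

(** The averaging step, by contradiction: a deficit of red in every image of [F] adds up to more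
    than the one edge by which [B] may exceed [R]. *)
Lemma perm_meet_half (R B : {set {set complete n}}) :
  F \subset edges (complete n) -> two_coloring R B ->
  #|B| <= #|R|.+1 -> 1 < n -> exists s, #|F|./2 <= #|orb s :&: R|.
Proof.
move=> FE col leBR n_gt1; apply/existsP.
apply: contraT; rewrite negb_exists => /forallP few'.
have few s : #|orb s :&: R| < #|F|./2 by rewrite ltnNge; apply: few'.
have [c cE] := sum_perm_meet.
have orbE s : orb s \subset edges (complete n).
  apply/subsetP => _ /imsetP[A /(subsetP FE)/card_edge A2 ->].
  by rewrite edges_complete inE card_imset ?A2 //; apply: perm_inj.
have orb_card s : #|orb s| = #|F| by rewrite card_imset //; apply/imset_inj/perm_inj.
have subRB : R \subset edges (complete n) /\ B \subset edges (complete n).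
  by case/andP: col => /eqP <- _; rewrite subsetUl subsetUr.
set m := #|{perm complete n}|.
have m_gt0 : 0 < m by apply/card_gt0P; exists 1%g.
(* Fewer than [#|F|./2] red edges means at least two more blue than red ones, in each of the [m]
   images. *)
have gap : c * #|R| + m * 2 <= c * #|B|.
  rewrite -!cE ?(proj1 subRB) ?(proj2 subRB) // -sum_nat_const -big_split /=.
  apply: leq_sum => s _; have := card_meet_coloring _ _ _ col (orbE s).
  have := few s; rewrite orb_card.
  move: #|orb s :&: R| #|orb s :&: B| => r b; lia.
have total : c * 'C(n, 2) = m * #|F|.
  rewrite -card_edges_complete -cE // -sum_nat_const; apply: eq_bigr => s _.
  by rewrite (setIidPl (orbE s)) orb_card.
have cm : m * 2 <= c.
  have : c * #|B| <= c * #|R|.+1 by rewrite leq_mul2l leBR orbT.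
  by rewrite mulnS; lia.
have leF : #|F| <= 'C(n, 2) by rewrite -card_edges_complete subset_leq_card.
have C_gt0 : 0 < 'C(n, 2) by rewrite bin_gt0.
(* [total] and [leF] bound [c] by [m], against [cm], since [m] and the binomial are positive. *)
have : m * 2 * 'C(n, 2) <= m * 'C(n, 2).
  by rewrite (leq_trans (leq_mul cm (leqnn _))) // total leq_mul2l leF orbT.
by rewrite leq_mul2r leqNgt; lia.
Qed.

End Averaging.

(** Only the removed edge [e1] can leave the intersection with [S]. *)
Lemma edge_replacement_meet (n : nat) (F H S : {set {set complete n}}) :
  edge_replacement F H -> #|F :&: S| <= #|H :&: S|.+1.
Proof.
case/exists_inP=> e1 _ /exists_inP[e2 _ /eqP ->].
apply: leq_trans (subset_leq_card (B := mem (e1 |: ((e2 |: F :\ e1) :&: S))) _) _.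
  by apply/subsetP => A; rewrite !inE; case: eqVneq => //= _ /andP[-> ->]; rewrite orbT.
by rewrite cardsU1; case: (_ \notin _) => //=; lia.
Qed.

Lemma path_crossing (n : nat) (G : sgraph) (R B F : {set {set complete n}})
    (s : seq {set {set complete n}}) :
  two_coloring R B -> path (@edge_replacement n) F s ->
  is_copy G F -> all (is_copy G (n := n)) s ->
  #|edges G|./2 <= #|F :&: R| -> #|edges G|./2 <= #|last F s :&: B| ->
  exists H, [/\ is_copy G H, #|edges G|./2 <= #|H :&: R|
              & #|edges G|./2 <= #|H :&: B|].
Proof.
move=> col; elim: s F => [|H s IH] F /=; first by move=> _ ? _; exists F.
case/andP=> FH pH cF /andP[cH cs] FR lastB.
have [FB|FB] := leqP #|edges G|./2 #|F :&: B|; first by exists F.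
(* Too few blue edges in [F] leave more than [#|edges G|./2] red ones, so [H] can lose one and still
   meet the red bound. *)
apply: (IH H) => //; have := edge_replacement_meet _ _ _ R FH.
have := card_meet_coloring _ _ _ _ col (copy_sub _ _ cF); rewrite (copy_card _ _ cF).
by lia.
Qed.

(** The two counts add up to [#|edges G|], so these lower bounds leave only the balanced splits. *)
Lemma balanced_copyP (n : nat) (G : sgraph) (R B F : {set {set complete n}}) :
  two_coloring R B -> is_copy G F ->
  #|edges G|./2 <= #|F :&: R| -> #|edges G|./2 <= #|F :&: B| ->
  balanced_copy G R B F.
Proof.
move=> col cF; have := card_meet_coloring _ _ _ _ col (copy_sub _ _ cF).
rewrite (copy_card _ _ cF) /balanced_copy /colored_copy cF uphalfE /=.
by case: ifP; lia.
Qed.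

Lemma two_coloringC (n : nat) (R B : {set {set complete n}}) :
  two_coloring R B -> two_coloring B R.
Proof. by rewrite /two_coloring setUC disjoint_sym. Qed.

Theorem theorem2p15 (G : sgraph) (hG : amoeba G) : balanceable G.
Proof.
case: hG => n0 [ltGn0 chain]; exists (maxn n0 3) => n.
rewrite geq_max => /andP[le_n0n n_gt2].
have C_gt2 : 2 < 'C(n, 2) by apply: leq_trans (leq_bin2l 2 n_gt2).
rewrite /bal; case: ex_minnP => b _ b_min.
(* [C_gt2] makes the half positive, so its predecessor is strictly smaller. Exceeding this threshold
   puts at least ['C(n, 2)./2] edges in each class, so the classes differ by at most one edge. *)
apply: leq_ltn_trans (b_min ('C(n, 2)./2.-1) _) _; last by lia.
apply/forallP => R; apply/forallP => B; apply/implyP => /andP[col].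
rewrite leq_min => /andP[ltR ltB].
have cardRB : #|R| + #|B| = 'C(n, 2).
  rewrite -card_edges_complete -(card_meet_coloring _ _ _ _ col (subxx _)).
  by case/andP: col => /eqP <- _; rewrite setUK setUC setUK.
have [F cF] := copy_ex G n (leq_trans (ltnW ltGn0) le_n0n).
have FE := copy_sub _ _ cF; have n_gt1 := ltnW n_gt2.
have [s sR] : exists s : {perm complete n},
    #|F|./2 <= #|[set s @: A | A : {set complete n} in F] :&: R|.
  by apply: perm_meet_half col _ n_gt1 => //; lia.
have [t tB] : exists t : {perm complete n},
    #|F|./2 <= #|[set t @: A | A : {set complete n} in F] :&: B|.
  by apply: perm_meet_half (two_coloringC _ _ _ col) _ n_gt1 => //; lia.
rewrite (copy_card _ _ cF) in sR tB.
have [p [pP pC pL]] := chain n le_n0n _ _ (copy_perm _ _ s _ cF) (copy_perm _ _ t _ cF).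
have [||H [cH HR HB]] := path_crossing _ _ _ _ _ _ col pP _ pC sR.
- exact: copy_perm.
- by rewrite pL.
by apply/existsP; exists H; apply: balanced_copyP.
Qed.
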